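(* Let $n\geq3$. The complex Stiefel manifold $W_{2^{n-1}-1,2}$ of orthonormal $2$-frames in the Hermitian space $\widetilde{\mathbb{A}}_n\cong\mathbb{C}^{2^{n-1}-1}$ is $$W_{2^{n-1}-1,2}=\{(a,b)\in V_{2^n-2,2}:\ b\in\mathbb{H}_a^\perp\}.$$
   Context: Cayley-Dickson algebras: $\mathbb{A}_0=\mathbb{R}$ with $\overline{x}=x$, and $\mathbb{A}_{m+1}=\mathbb{A}_m\times\mathbb{A}_m$ with product $(a,b)(x,y)=(ax-\overline{y}b,\;ya+b\overline{x})$ and conjugation $\overline{(x_1,x_2)}=(\overline{x}_1,-x_2)$. $\mathbb{A}_m=\mathbb{R}^{2^m}$ carries the standard inner product $\langle\cdot,\cdot\rangle$ and norm; $\perp$ denotes orthogonality or orthogonal complement. $e_0$ is the unit. For $m\geq1$, $\widetilde{e}_0:=(0,e_0)\in\mathbb{A}_m$, and for $a=(a_1,a_2)\in\mathbb{A}_m$, $\widetilde{a}:=(-a_2,a_1)$. The doubly pure elements are $\widetilde{\mathbb{A}}_m=\{e_0,\widetilde{e}_0\}^\perp\subset\mathbb{A}_m$. $\widetilde{\mathbb{A}}_n$ is a complex vector space of dimension $2^{n-1}-1$ with $i\cdot a=\widetilde{a}$, and is given the Hermitian inner product $(a,b)\mapsto\langle a,b\rangle-i\langle\widetilde{a},b\rangle$ (complex linear in the first variable). $V_{2^n-2,2}=\{(a,b)\in\widetilde{\mathbb{A}}_n\times\widetilde{\mathbb{A}}_n:\ \|a\|=\|b\|=1,\ a\perp b\}$.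 For $a\neq0$ in $\widetilde{\mathbb{A}}_n$, $\mathbb{H}_a=\mathrm{Span}\{e_0,\widetilde{a},a,\widetilde{e}_0\}\subset\mathbb{A}_n$. *)

(* Defs.v *)
From HB Require Import structures.
From mathcomp Require Import all_boot all_order all_algebra.
From mathcomp Require Import classical_sets reals complex.

Set Implicit Arguments.
Unset Strict Implicit.
Unset Printing Implicit Defensive.

Import Order.TTheory GRing.Theory Num.Theory.
Local Open Scope ring_scope.
Local Open Scope complex_scope.

Section CayleyDickson.
Variable R : rcfType.

Fixpoint cd (m : nat) : vectType R :=
  if m is m'.+1 then (cd m' * cd m')%type else R^o.

Fixpoint cd_conj (m : nat) : cd m -> cd m :=
  match m return cd m -> cd m with
  | 0 => fun a => a
  | m'.+1 => fun a => (cd_conj a.1, - a.2)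
  end.

Fixpoint cd_mul (m : nat) : cd m -> cd m -> cd m :=
  match m return cd m -> cd m -> cd m with
  | 0 => fun a x => (a : R) * (x : R)
  | m'.+1 => fun a x =>
      (cd_mul a.1 x.1 - cd_mul (cd_conj x.2) a.2,
       cd_mul x.2 a.1 + cd_mul a.2 (cd_conj x.1))
  end.

Fixpoint cd_dot (m : nat) : cd m -> cd m -> R :=
  match m return cd m -> cd m -> R with
  | 0 => fun a b => (a : R) * (b : R)
  | m'.+1 => fun a b => cd_dot a.1 b.1 + cd_dot a.2 b.2
  end.

Fixpoint cd_e0 (m : nat) : cd m :=
  match m return cd m with
  | 0 => (1 : R)
  | m'.+1 => (cd_e0 m', 0)
  end.

(* [cd_te0] and [cd_tilde] are only meaningful for positive [m];
   at [m = 0] they take the dummy value 0. *)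
Definition cd_te0 (m : nat) : cd m :=
  match m return cd m with
  | 0 => 0
  | m'.+1 => (0, cd_e0 m')
  end.

Definition cd_tilde (m : nat) : cd m -> cd m :=
  match m return cd m -> cd m with
  | 0 => fun _ => 0
  | m'.+1 => fun a => (- a.2, a.1)
  end.

Lemma cd_dot_bilinear m :
  bilinear_for (GRing.Scale.Law.clone _ _ ( *%R ) _)
    (GRing.Scale.Law.clone _ _ (idfun \; *%R) _) (@cd_dot m).
Proof.
split=> u a x y.
  elim: m u x y => [|m IH] u x y /=.
    by rewrite mulrDl -mulrA.
  by rewrite !IH mulrDr addrACA.
elim: m u x y => [|m IH] u x y /=.
  by rewrite mulrDr mulrCA.
by rewrite !IH /= mulrDr addrACA.
Qed.

HB.instance Definition _ m := isBilinear.Build R (cd m) (cd m) R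
  *%R (idfun \; *%R) (@cd_dot m)
  (fun u => zmod_morphism_linear ((cd_dot_bilinear m).1 u))
  (fun u => zmod_morphism_linear ((cd_dot_bilinear m).2 u))
  (fun u => scalable_linear ((cd_dot_bilinear m).1 u))
  (fun u => scalable_linear ((cd_dot_bilinear m).2 u)).

Lemma cd_dotC m (a b : cd m) : cd_dot a b = cd_dot b a.
Proof. by elim: m a b => [|m IH] a b /=; rewrite 1?mulrC // !(IH a.1, IH a.2). Qed.

Lemma cd_dot_hermitian m (a b : cd m) :
  cd_dot a b = (-1) ^+ false * idfun (cd_dot b a).
Proof. by rewrite expr0 mul1r cd_dotC. Qed.

HB.instance Definition _ m := isHermitianSesquilinear.Build R (cd m) false idfun
  (@cd_dot m) (@cd_dot_hermitian m).

Lemma cd_dot_ge0 m (a : cd m) : 0 <= cd_dot a a.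
Proof. by elim: m a => [|m IH] a /=; rewrite -?expr2 ?sqr_ge0 ?addr_ge0. Qed.

Lemma cd_dot_gt0 m (a : cd m) : a != 0 -> 0 < cd_dot a a.
Proof.
move=> a0; rewrite lt0r cd_dot_ge0 andbT; apply: contra a0.
elim: m a => [|m IH] a /=; first by rewrite mulf_eq0 orbb.
rewrite paddr_eq0 ?cd_dot_ge0 // => /andP[/IH/eqP a1 /IH/eqP a2].
by rewrite (surjective_pairing a) a1 a2.
Qed.

HB.instance Definition _ m := isDotProduct.Build R (cd m) (@cd_dot m)
  (@cd_dot_gt0 m).

Definition cd_norm m (a : cd m) : R := Num.sqrt (cd_dot a a).

Lemma cd_conj_e0 m : cd_conj (cd_e0 m) = cd_e0 m.
Proof. by elim: m => //= m ->; rewrite oppr0. Qed.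

Lemma cd_conj0 m : cd_conj (0 : cd m) = 0.
Proof. by elim: m => //= m ->; rewrite oppr0. Qed.

Lemma cd_mul0 m : (forall a : cd m, cd_mul 0 a = 0) /\
  (forall a : cd m, cd_mul a 0 = 0).
Proof.
elim: m => [|m [IHl IHr]] /=; first by split=> a; rewrite ?mul0r ?mulr0.
by split=> a; rewrite ?cd_conj0 !(IHl, IHr) subrr addr0.
Qed.

Lemma cd_e0_unit m :
  left_id (cd_e0 m) (@cd_mul m) /\ right_id (cd_e0 m) (@cd_mul m).
Proof.
elim: m => [|m [IHl IHr]] /=; first by split=> a; rewrite ?mul1r ?mulr1.
by split=> -[a1 a2] /=;
  rewrite ?cd_conj_e0 ?cd_conj0 !(IHl, IHr, (cd_mul0 m).1, (cd_mul0 m).2) ?subr0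
    ?addr0 ?add0r.
Qed.

Lemma cd_tildeE m (a : cd m.+1) : cd_tilde a = cd_mul a (cd_te0 m.+1).
Proof.
by rewrite /= cd_conj_e0 cd_conj0 !(cd_mul0 m).2 !(cd_e0_unit m).1 sub0r addr0.
Qed.

Lemma dim_cd m : \dim {: cd m} = (2 ^ m)%N.
Proof.
rewrite dimvf; elim: m => [//|m IH].
by rewrite expnS mul2n -addnn -{1}IH -IH.
Qed.

Lemma cd_tilde_is_linear m : linear (@cd_tilde m).
Proof.
case: m => [|m] k a b /=; first by rewrite scaler0 addr0.
by apply/eqP/andP; split; rewrite /= ?eqxx // scalerN -opprD.
Qed.

HB.instance Definition _ m := GRing.isLinear.Build R (cd m) (cd m) _
  (@cd_tilde m) (@cd_tilde_is_linear m).

Lemma cd_tildeD m : {morph @cd_tilde m : a b / a + b}.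
Proof. exact: linearD. Qed.

Lemma cd_tildeZ m k : {morph @cd_tilde m : a / k *: a}.
Proof. exact: linearZ. Qed.

Lemma cd_dotDl m (a b c : cd m) : cd_dot (a + b) c = cd_dot a c + cd_dot b c.
Proof. by rewrite linearDl. Qed.

Lemma cd_dotZl m k (a c : cd m) : cd_dot (k *: a) c = k * cd_dot a c.
Proof. by rewrite linearZl_LR. Qed.

Lemma cd_dotNl m (a c : cd m) : cd_dot (- a) c = - cd_dot a c.
Proof. by rewrite linearNl. Qed.

Lemma cd_dot_tilde m (a b : cd m) : cd_dot (cd_tilde a) b = - cd_dot a (cd_tilde b).
Proof.
case: m a b => [|m] a b; first by rewrite linear0l linear0r oppr0.
by rewrite /= linearNl linearNr opprD opprK addrC.
Qed.

Lemma cd_tilde_e0 m : cd_tilde (cd_e0 m) = cd_te0 m.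
Proof. by case: m => //= m; rewrite oppr0. Qed.

Lemma cd_tilde_te0 m : cd_tilde (cd_te0 m.+1) = - cd_e0 m.+1.
Proof. by congr pair; rewrite /= oppr0. Qed.

Definition dpure_space m : {vspace cd m} :=
  orthov (@cd_dot m) <<[:: cd_e0 m; cd_te0 m]>>%VS.

Lemma dpure_spaceP m (a : cd m) :
  reflect (cd_dot a (cd_e0 m) = 0 /\ cd_dot a (cd_te0 m) = 0)
    (a \in dpure_space m).
Proof.
apply: (iffP idP) => [/mem_orthovP h|[h0 h1]].
  by split; apply: h; rewrite memv_span // !inE eqxx ?orbT.
apply/mem_orthovP => v; rewrite span_cons span_seq1.
move=> /memv_addP[_ /vlineP[x ->] [_ /vlineP[y ->] ->]].
by rewrite linearDr !linearZr_LR /= h0 h1 !mulr0 addr0.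
Qed.

Lemma cd_tilde_dpure m (a : cd m) :
  a \in dpure_space m -> cd_tilde a \in dpure_space m.
Proof.
move=> /dpure_spaceP[h0 h1]; apply/dpure_spaceP.
rewrite !cd_dot_tilde cd_tilde_e0 h1 oppr0; split=> //.
case: m a h0 h1 => [|m] a h0 h1; first by rewrite linear0 linear0r oppr0.
have -> : cd_dot a (cd_tilde (cd_te0 m.+1)) = - cd_dot a (cd_e0 m.+1).
  by rewrite cd_tilde_te0 linearNr.
by rewrite h0 !oppr0.
Qed.

Lemma cd_tildeK m (a : cd m) : a \in dpure_space m -> cd_tilde (cd_tilde a) = - a.
Proof.
case: m a => [|m] a; last by move=> _; rewrite (surjective_pairing a).
by move=> /dpure_spaceP[/= + _]; rewrite mulr1 => ->; rewrite oppr0.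
Qed.

(* A separate name, so that the carrier gets the complex scaling
   instead of the real one of [subvs_of]. *)
Definition dpure (m : nat) : Type := subvs_of (dpure_space m).

HB.instance Definition _ m := GRing.Zmodule.on (dpure m).

Definition dpure_val m (a : dpure m) : cd m := vsval a.
Coercion dpure_val : dpure >-> Vector.sort.

Definition dpure_tilde m (a : dpure m) : dpure m :=
  Subvs (cd_tilde_dpure (subvsP a)).

Definition dpure_scale m (z : R[i]) (a : dpure m) : dpure m :=
  vsproj (dpure_space m)
    (complex.Re z *: (a : cd m) + complex.Im z *: (dpure_tilde a : cd m)).

Lemma dpure_valP m (a : dpure m) : dpure_val a \in dpure_space m.
Proof. exact: subvsP. Qed.

Lemma dpure_valI m : injective (@dpure_val m).
Proof. exact: val_inj. Qed.

Lemma dpure_valD m (a b : dpure m) :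
  dpure_val (a + b) = dpure_val a + dpure_val b.
Proof. by []. Qed.

Lemma dpure_val_tilde m (a : dpure m) : dpure_val (dpure_tilde a) = cd_tilde a.
Proof. by []. Qed.

Lemma dpure_val_scale m z (a : dpure m) :
  dpure_val (dpure_scale z a) = complex.Re z *: dpure_val a + complex.Im z *: cd_tilde a.
Proof.
by rewrite /dpure_scale /dpure_val vsprojK // memvD ?memvZ ?subvsP.
Qed.

Lemma dpure_scaleA m (z w : R[i]) (a : dpure m) :
  dpure_scale z (dpure_scale w a) = dpure_scale (z * w) a.
Proof.
apply: dpure_valI; rewrite !dpure_val_scale cd_tildeD !cd_tildeZ.
rewrite cd_tildeK ?dpure_valP //; case: z w => [x y] [x' y'] /=.
rewrite !scalerDr !scalerA scalerN -scaleNr [X in _ + X]addrC addrACA.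
by rewrite -!scalerDl.
Qed.

Lemma dpure_scale1 m : left_id 1 (@dpure_scale m).
Proof.
by move=> a; apply: dpure_valI; rewrite dpure_val_scale /= scale1r scale0r addr0.
Qed.

Lemma dpure_scaleDr m : right_distributive (@dpure_scale m) +%R.
Proof.
move=> z a b; apply: dpure_valI; rewrite dpure_valD !dpure_val_scale dpure_valD.
by rewrite cd_tildeD !scalerDr addrACA.
Qed.

Lemma dpure_scaleDl m (a : dpure m) :
  {morph (@dpure_scale m)^~ a : z w / z + w}.
Proof.
move=> [x y] [x' y']; apply: dpure_valI; rewrite dpure_valD !dpure_val_scale /=.
by rewrite !scalerDl addrACA.
Qed.

HB.instance Definition _ m := GRing.Zmodule_isLmodule.Build R[i] (dpure m)
  (@dpure_scaleA m) (@dpure_scale1 m) (@dpure_scaleDr m) (@dpure_scaleDl m).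

Lemma dpure_valZ m z (a : dpure m) :
  dpure_val (z *: a) = complex.Re z *: dpure_val a + complex.Im z *: cd_tilde a.
Proof. exact: dpure_val_scale. Qed.

Lemma dpure_scalei m (a : dpure m) : ('i : R[i]) *: a = dpure_tilde a.
Proof. by apply: dpure_valI; rewrite dpure_valZ /= scale0r add0r scale1r. Qed.

Lemma dim_cd_pure m :
  \dim (orthov (@cd_dot m) <[cd_e0 m]>) = (2 ^ m).-1.
Proof.
rewrite -dim_cd -[orthov _ _]capfv -(@eq_dim_orthov1 _ false idfun) //.
apply/mem_orthovPn; exists (cd_e0 m); first exact: memvf.
suff e : cd_dot (cd_e0 m) (cd_e0 m) = 1.
  suff : cd_dot (cd_e0 m) (cd_e0 m) != 0 by [].
  by rewrite e oner_neq0.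
by elim: m => [|m IH] /=; rewrite ?mulr1 // IH linear0l addr0.
Qed.

Lemma dpure_spaceS m (a : cd m.+1) :
  a \in dpure_space m.+1 =
  (a.1 \in orthov (@cd_dot m) <[cd_e0 m]>) &&
  (a.2 \in orthov (@cd_dot m) <[cd_e0 m]>).
Proof.
rewrite !mem_orthov1.
by apply/dpure_spaceP/andP => /= -[];
  rewrite !linear0r !(addr0, add0r) => h h'; split; apply/eqP.
Qed.

Fact dpure_vect_iso m : Vector.axiom (2 ^ m.-1).-1 (dpure m).
Proof.
case: m => [|m].
  exists (fun _ => 0) => [z a b|]; first by rewrite scaler0 addr0.
  exists (fun _ => 0) => [a|v]; last by rewrite [v]thinmx0.
  apply/esym/dpure_valI; have /dpure_spaceP[/=] := dpure_valP a.
  by rewrite mulr1.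
rewrite /= -dim_cd_pure; set P := orthov _ _.
pose f (a : dpure m.+1) : 'rV[R[i]]_(\dim P) :=
  \row_i (coord (vbasis P) i (dpure_val a).1 +i* coord (vbasis P) i (dpure_val a).2).
pose s (t : R[i] -> R) (v : 'rV[R[i]]_(\dim P)) : cd m :=
  \sum_i t (v 0 i) *: (vbasis P)`_i.
have sP t v : s t v \in P.
  by apply: memv_suml => i _; rewrite memvZ // vbasis_mem // mem_nth ?size_tuple.
pose g v : dpure m.+1 := vsproj (dpure_space m.+1) (s (@complex.Re R) v, s (@complex.Im R) v).
have gE v : dpure_val (g v) = (s (@complex.Re R) v, s (@complex.Im R) v).
  by rewrite /dpure_val vsprojK // dpure_spaceS !sP.
exists f.
  move=> [x y] a b; apply/rowP => i.
  rewrite !mxE dpure_valD dpure_valZ /= !linearD !linearZ /= linearN mulrN.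
  by apply/eqP; rewrite eq_complex /= !eqxx.
exists g => [a|v].
  apply: dpure_valI; rewrite gE; have := dpure_valP a; rewrite dpure_spaceS.
  move=> /andP[/coord_vbasis a1 /coord_vbasis a2].
  rewrite [RHS]surjective_pairing; congr pair; rewrite [RHS](a1, a2);
    by apply: eq_bigr => i _; rewrite mxE.
apply/rowP => i; rewrite mxE gE /= !coord_sum_free ?(basis_free (vbasisP _)) //.
by case: (v 0 i).
Qed.

HB.instance Definition _ m := Lmodule_hasFinDim.Build R[i] (dpure m)
  (@dpure_vect_iso m).

Lemma dim_dpure m : \dim {: dpure m} = (2 ^ m.-1).-1.
Proof. by rewrite dimvf. Qed.

Definition dpure_herm m (a b : dpure m) : R[i] :=
  (cd_dot a b)%:C - 'i * (cd_dot (cd_tilde a) b)%:C.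

Lemma dpure_hermE m (a b : dpure m) :
  dpure_herm a b = cd_dot a b -i* cd_dot (cd_tilde a) b.
Proof.
by apply/eqP; rewrite eq_complex /= !(mul0r, mul1r, mulr0) subrr !add0r subr0 !eqxx.
Qed.

Lemma dpure_hermC m (a b : dpure m) :
  dpure_herm a b = (-1) ^+ false * (dpure_herm b a)^*%R.
Proof.
rewrite expr0 mul1r !dpure_hermE -[RHS]/(_ +i* _) opprK cd_dotC.
by rewrite cd_dot_tilde opprK (cd_dotC (dpure_val a)).
Qed.

Lemma dpure_herm_linearl m (b : dpure m) :
  GRing.linear_for *%R ((@dpure_herm m)^~ b).
Proof.
move=> [x y] a c; rewrite !dpure_hermE dpure_valD dpure_valZ /=.
rewrite !linearD !linearZ /= cd_tildeK ?dpure_valP //.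
rewrite !(linearDl, linearZl_LR, linearNl) /=.
apply/eqP; rewrite eq_complex /=; apply/andP; split; apply/eqP.
  by rewrite !mulrN opprK.
by rewrite !mulrN !opprD opprK [X in X + _]addrC.
Qed.

Lemma dpure_herm_bilinear m :
  bilinear_for (GRing.Scale.Law.clone _ _ ( *%R ) _)
    (GRing.Scale.Law.clone _ _ (Num.conj \; *%R) _) (@dpure_herm m).
Proof.
split=> [|b z a c]; first exact: dpure_herm_linearl.
rewrite dpure_hermC dpure_herm_linearl rmorphD rmorphM /=.
by rewrite mulrDr mulrCA -!dpure_hermC.
Qed.

HB.instance Definition _ m := isBilinear.Build R[i] (dpure m) (dpure m) R[i]
  *%R (Num.conj \; *%R) (@dpure_herm m)
  (fun u => zmod_morphism_linear ((dpure_herm_bilinear m).1 u))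
  (fun u => zmod_morphism_linear ((dpure_herm_bilinear m).2 u))
  (fun u => scalable_linear ((dpure_herm_bilinear m).1 u))
  (fun u => scalable_linear ((dpure_herm_bilinear m).2 u)).

HB.instance Definition _ m := isHermitianSesquilinear.Build R[i] (dpure m)
  false Num.conj (@dpure_herm m) (@dpure_hermC m).

Lemma dpure_herm_gt0 m (a : dpure m) : a != 0 -> 0 < dpure_herm a a.
Proof.
move=> a0; rewrite dpure_hermE ltcE /=.
have aa : cd_dot (cd_tilde a) a = 0.
  have : cd_dot (cd_tilde a) a = - cd_dot (cd_tilde a) a.
    by rewrite {1}cd_dot_tilde cd_dotC.
  by move/eqP; rewrite -addr_eq0 -mulr2n mulrn_eq0 => /eqP.
by rewrite aa oppr0 eqxx cd_dot_gt0.
Qed.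

HB.instance Definition _ m := isDotProduct.Build R[i] (dpure m) (@dpure_herm m)
  (@dpure_herm_gt0 m).

(* For [V] of complex dimension N this is W_{N,2}; see [dim_dpure] for the
   dimension of [dpure m]. *)
Definition complex_stiefel2 (V : lmodType R[i]) (h : {dot V for Num.conj}) :
  set (V * V) := [set ab | orthonormal h [:: ab.1; ab.2]].

(* V_{2^m-2,2} *)
Definition real_stiefel2 m : set (dpure m * dpure m) :=
  [set ab : dpure m * dpure m | [/\ cd_norm ab.1 = 1, cd_norm ab.2 = 1 & cd_dot ab.1 ab.2 = 0]].

(* H_a *)
Definition cd_quat m (a : cd m) : {vspace cd m} :=
  <<[:: cd_e0 m; cd_tilde a; a; cd_te0 m]>>%VS.

End CayleyDickson.

Arguments dpure_herm {R m}.
Arguments cd_dot {R m}.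

(* Main.v *)
(* The real part of the Hermitian product of a and b is <a, b> and its imaginary
   part is -<~a, b>, while <~a, a> = 0.  A doubly pure b is orthogonal to e_0 and
   ~e_0, so b lies in the orthogonal complement of H_a exactly when
   <a, b> = <~a, b> = 0, that is, when a and b are Hermitian orthogonal. *)
Require Import Defs.
From mathcomp Require Import all_boot all_order all_algebra.
From mathcomp Require Import classical_sets reals complex.

Import GRing.Theory Num.Theory.
Local Open Scope ring_scope.
Local Open Scope classical_set_scope.

(** [cd_tilde] is skew-adjoint for the symmetric form [cd_dot], so this value equals its own
    opposite. *)
Lemma cd_dot_tilde_self (R : rcfType) (m : nat) (a : cd R m) :
  cd_dot (cd_tilde a) a = 0.
Proof.
have /eqP : cd_dot (cd_tilde a) a = - cd_dot (cd_tilde a) a.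
  by rewrite {1}cd_dot_tilde cd_dotC.
by rewrite -addr_eq0 -mulr2n mulrn_eq0 => /eqP.
Qed.

Lemma cd_norm_eq1 (R : rcfType) (m : nat) (a : cd R m) :
  cd_norm a = 1 <-> cd_dot a a = 1.
Proof.
rewrite /cd_norm; split=> [h|->]; last exact: sqrtr1.
by rewrite -[LHS]sqr_sqrtr ?cd_dot_ge0 // h expr1n.
Qed.

(** The imaginary part of [dpure_herm a a] vanishes, leaving the squared real norm. *)
Lemma dpure_herm_eq1 (R : rcfType) (m : nat) (a : dpure R m) :
  dpure_herm a a = 1 <-> cd_norm a = 1.
Proof.
rewrite cd_norm_eq1 dpure_hermE cd_dot_tilde_self oppr0.
by split=> [[]|->].
Qed.

Lemma dpure_herm_eq0 (R : rcfType) (m : nat) (a b : dpure R m) :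
  dpure_herm a b = 0 <-> cd_dot a b = 0 /\ cd_dot (cd_tilde a) b = 0.
Proof.
rewrite dpure_hermE; split=> [[-> /eqP]|[-> ->]]; last by rewrite oppr0.
by rewrite oppr_eq0 => /eqP ->.
Qed.

Lemma orthov_cd_quat (R : rcfType) (m : nat) (a : cd R m) (b : dpure R m) :
  dpure_val b \in orthov cd_dot (cd_quat a) <->
  cd_dot a b = 0 /\ cd_dot (cd_tilde a) b = 0.
Proof.
have /dpure_spaceP[] := dpure_valP b; rewrite !(cd_dotC (dpure_val b)) => b0 b1.
split=> [/mem_orthovP h|[hb htb]].
  by rewrite !(cd_dotC _ (dpure_val b)); split;
    apply: h; rewrite memv_span // !inE eqxx ?orbT.
(* Swapping sides puts the span on the left of an inclusion, so only its four generators need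
   checking. *)
rewrite mem_orthov_sym; apply/span_subvP => v.
by rewrite !inE mem_orthov1 => /or4P[] /eqP ->; apply/eqP.
Qed.

Theorem proposition2p5 (R : realType) (n : nat) (hn : (3 <= n)%N) :
  complex_stiefel2 (dpure_herm : {dot (dpure R n) for Num.conj}) =
  [set ab : dpure R n * dpure R n |
    real_stiefel2 ab /\ dpure_val ab.2 \in orthov cd_dot (cd_quat ab.1)].
Proof.
apply/seteqP; split=> -[a b] /=.
  (* On a two-element list, [orthonormal] unfolds to two unit conditions and one orthogonality. *)
  rewrite /complex_stiefel2 /= /orthonormal /= !andbT.
  move=> /andP[/andP[/eqP/dpure_herm_eq1 ha /eqP/dpure_herm_eq1 hb]].
  move=> /eqP hab; split; last exact/orthov_cd_quat/dpure_herm_eq0.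
  (* Real orthogonality is the real part of [hab]. *)
  by split=> //; have /dpure_herm_eq0[] := hab.
move=> [[ha hb _] /orthov_cd_quat/dpure_herm_eq0 hab].
rewrite /complex_stiefel2 /= /orthonormal /= !andbT.
by apply/andP; split; [apply/andP; split; apply/eqP/dpure_herm_eq1|apply/eqP].
Qed.
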